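(* Let $k$ be an algebraically closed field of characteristic $p>3$, let $\mathfrak{g}=W_1$ be the Witt algebra over $k$, and let $\mathscr{B}^+=\mathfrak{g}_0$ be its standard Borel subalgebra, whose nilpotent variety $\{x\in\mathscr{B}^+\mid x^{[p]}=0\}$ is $\mathfrak{g}_1$. Then the nilpotent commuting variety $\mathscr{C}(\mathfrak{g}_1)=\{(x,y)\in\mathfrak{g}_1\times\mathfrak{g}_1\mid [x,y]=0\}$ of $\mathscr{B}^+$ is reducible and equidimensional. More precisely, $$\mathscr{C}(\mathfrak{g}_1)=\bigcup_{i=1}^{(p-3)/2}\mathfrak{C}(i)$$ is the decomposition of $\mathscr{C}(\mathfrak{g}_1)$ into irreducible components, where $\mathfrak{C}(i)$ is the Zariski closure of $\{(x,y)\in\mathscr{N}\times\mathscr{N}\mid x\in\mathfrak{g}_i\setminus\mathfrak{g}_{i+1},\,[x,y]=0\}$ and $\mathscr{N}=\{x\in\mathfrak{g}\mid x^{[p]}=0\}$. In particular, $\dim\mathscr{C}(\mathfrak{g}_1)=p$.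
   Context: Let $\mathfrak{A}=k[X]/(X^p)$ and let $D$ be the derivation of $\mathfrak{A}$ with $D(X^i)=iX^{i-1}$ for $0\le i\le p-1$. The Witt algebra $W_1$ is the Lie algebra of $k$-linear derivations of $\mathfrak{A}$, with basis $X^iD$, $0\le i\le p-1$; it is a restricted Lie algebra whose $[p]$-map is the $p$-th power of derivations as linear operators. Set $\mathfrak{g}_{[j]}=kX^{j+1}D$ for $-1\le j\le p-2$ and $\mathfrak{g}_i=\sum_{j\ge i}\mathfrak{g}_{[j]}$ for $i\geq -1$ (so $\mathfrak{g}_{p-1}=0$). Varieties are Zariski closed subsets of finite-dimensional affine spaces over $k$; the closures are taken in $\mathfrak{g}\times\mathfrak{g}$. Equidimensional means that all irreducible components have the same dimension. ''The decomposition into irreducible components'' means that the $\mathfrak{C}(i)$, $1\le i\le (p-3)/2$, are pairwise distinct and are exactly the irreducible components.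
   Formalization: Reducibility of the nilpotent commuting variety is asserted only for p > 5, because for p = 5 it is {x_1y_2 = x_2y_1} × k^2, which is irreducible (a single component); all other claims are for p > 3. *)

(* Defs.v *)
From HB Require Import structures.
From mathcomp Require Import all_boot all_order all_algebra ring.
From mathcomp Require Import mpoly.
From mathcomp Require Import classical_sets.

Set Implicit Arguments.
Unset Strict Implicit.
Unset Printing Implicit Defensive.

Import GRing.Theory Num.Theory.
Local Open Scope ring_scope.

Section Zariski.
Local Open Scope classical_set_scope.
Variables (k : fieldType) (V : vectType k).
Implicit Types S F G : set V.

(* The polynomial functions on V are the polynomials in the coordinates with
   respect to one fixed basis; the closed sets do not depend on this basis. *)
Definition zcoord (v : V) : 'I_(\dim {:V}) -> k :=
  fun i => coord (vbasis {:V}) i v.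

Definition zlocus (I : set {mpoly k[\dim {:V}]}) : set V :=
  [set v | forall f, I f -> f.@[zcoord v] = 0].

Definition zclosed S : Prop := exists I, S = zlocus I.

Definition zclosure S : set V :=
  [set v | forall F, zclosed F -> S `<=` F -> F v].

Definition zirreducible S : Prop :=
  S !=set0 /\
  forall F G, zclosed F -> zclosed G -> S `<=` F `|` G -> S `<=` F \/ S `<=` G.

Definition zcomponent S (Z : set V) : Prop :=
  [/\ Z `<=` S, zirreducible Z &
      forall Z', Z' `<=` S -> zirreducible Z' -> Z `<=` Z' -> Z' = Z].

Definition zchain S (n : nat) (Z : nat -> set V) : Prop :=
  (forall i, (i <= n)%N -> [/\ zclosed (Z i), zirreducible (Z i) & Z i `<=` S])
  /\ (forall i, (i < n)%N -> Z i `<` Z i.+1).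

(* Krull dimension of a closed set S *)
Definition zdim S (d : nat) : Prop :=
  (exists Z, zchain S d Z) /\
  (forall n, (exists Z, zchain S n Z) -> (n <= d)%N).

Definition zequidimensional S : Prop :=
  exists d, forall Z, zcomponent S Z -> zdim Z d.

End Zariski.

Section Witt.
Variables (k : fieldType) (p : nat).

(* mathcomp's {poly %/ h} is k[X]/(h) as soon as h is monic of degree >= 1;
   its elements are represented by polynomials of degree < deg h. *)
Definition truncpoly := {poly %/ ('X^p : {poly k})}.
Local Notation A := truncpoly.
Local Notation x_ := (qpolyX ('X^p : {poly k})).

Lemma in_truncpoly_val (a : A) : in_qpoly 'X^p (val a) = a.
Proof. by apply/val_inj/in_qpoly_small/size_mk_monic. Qed.

Lemma truncpoly_span (a : A) : (0 < p)%N ->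
  a = \sum_(i < p) (val a)`_i *: x_ ^+ i.
Proof.
move=> p0; have sa : (size (val a) <= p)%N.
  have e : size (mk_monic ('X^p : {poly k})) = p.+1.
    by rewrite mk_monic_Xn size_polyXn prednK.
  by have := size_mk_monic a; rewrite [X in (_ < X)%N]e ltnS.
rewrite -{1}[a]in_truncpoly_val -{1}[val a]coefK poly_def.
rewrite (eq_bigr (fun i : 'I_(size (val a)) => (val a)`_i *: 'X^i)) //.
rewrite -(big_mkord xpredT (fun i => (val a)`_i *: 'X^i)).
rewrite -(big_mkord xpredT (fun i => (val a)`_i *: x_ ^+ i)).
rewrite (big_cat_nat (n := size (val a)) _ sa) //= [X in _ = _ + X]big1_seq.
  by rewrite addr0 linear_sum; apply: eq_bigr => i _; rewrite linearZ /= rmorphXn.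
by move=> i /=; rewrite mem_index_iota => /andP[/(nth_default 0) -> _]; rewrite scale0r.
Qed.

Definition is_derivation (d : 'End(A)) : Prop :=
  forall a b : A, d (a * b) = d a * b + a * d b.

Definition leibniz_defect (a b : A) (d : 'End(A)) : A :=
  d (a * b) - (d a * b + a * d b).

Fact leibniz_defect_is_linear a b : linear (leibniz_defect a b).
Proof.
move=> c d d'; rewrite /leibniz_defect !lfunE /= !lfunE /=.
rewrite mulrDl mulrDr -scalerAl -scalerAr scalerBr scalerDr !opprD !addrA.
set x1 := c *: _; set x2 := c *: _; set x3 := c *: _.
ring.
Qed.

HB.instance Definition _ a b :=
  GRing.isLinear.Build k 'End(A) A _ (leibniz_defect a b)
    (leibniz_defect_is_linear a b).

(* W_1 as a subspace of 'End(A); the Leibniz rule is imposed on the monomial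
   basis, which is the same as imposing it everywhere by [wittP]. *)
Definition witt : {vspace 'End(A)} :=
  (\bigcap_(i < p) \bigcap_(j < p)
     lker (linfun (leibniz_defect (x_ ^+ i) (x_ ^+ j))))%VS.

Lemma wittP (d : 'End(A)) : (0 < p)%N -> (d \in witt) <-> is_derivation d.
Proof.
move=> p0; split=> [dW a b|dD]; last first.
  rewrite memvE; apply/subv_bigcapP => i _; apply/subv_bigcapP => j _.
  rewrite -memvE memv_ker lfunE /= /leibniz_defect dD.
  by rewrite subrr.
have ld i j : (i < p)%N -> (j < p)%N ->
    d (x_ ^+ i * x_ ^+ j) = d (x_ ^+ i) * x_ ^+ j + x_ ^+ i * d (x_ ^+ j).
  move=> ip jp; move: dW; rewrite memvE.
  move=> /subv_bigcapP/(_ (Ordinal ip) isT)/subv_bigcapP/(_ (Ordinal jp) isT).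
  by rewrite -memvE memv_ker lfunE /= subr_eq0 => /eqP.
have lda i c : (i < p)%N -> d (x_ ^+ i * c) = d (x_ ^+ i) * c + x_ ^+ i * d c.
  move=> ip; rewrite {1 2 3}(truncpoly_span c p0) linear_sum !mulr_sumr.
  rewrite linear_sum -big_split; apply: eq_bigr => j _ /=.
  by rewrite -!scalerAr !linearZ /= -scalerAr ld // scalerDr.
rewrite {1 2 3}(truncpoly_span a p0) linear_sum !mulr_suml linear_sum.
rewrite -big_split; apply: eq_bigr => i _ /=.
by rewrite -!scalerAl !linearZ /= -scalerAl lda // scalerDr.
Qed.

Definition truncpoly_deriv (a : A) : A := in_qpoly 'X^p (a : {poly k})^`().

Fact truncpoly_deriv_is_linear : linear truncpoly_deriv.
Proof.
move=> c a b; rewrite /truncpoly_deriv -linearP; congr (in_qpoly _ _).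
by rewrite /= derivD derivZ.
Qed.

HB.instance Definition _ :=
  GRing.isLinear.Build k A A _ truncpoly_deriv truncpoly_deriv_is_linear.

Definition wittD : 'End(A) := linfun truncpoly_deriv.

Definition wittXD (m : nat) : 'End(A) := linfun (x_ ^+ m \*o wittD).

Lemma wittD_Xn i : (i < p)%N -> wittD (x_ ^+ i) = i%:R *: x_ ^+ i.-1.
Proof.
move=> ip; rewrite lfunE /= /truncpoly_deriv.
have p0 : (0 < p)%N by apply: leq_trans ip.
have -> : x_ ^+ i = in_qpoly 'X^p 'X^i by rewrite rmorphXn.
rewrite (@in_qpoly_small _ _ 'X^i).
  2: by rewrite mk_monic_Xn prednK // !size_polyXn.
by rewrite derivXn -scaler_nat linearZ /= rmorphXn.
Qed.

Lemma wittXDE m a : wittXD m a = x_ ^+ m * wittD a.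
Proof. by rewrite lfunE. Qed.

Lemma wittD_in q : p \in [pchar k] -> wittD (in_qpoly 'X^p q) = in_qpoly 'X^p q^`().
Proof.
move=> hp; have p0 : (0 < p)%N := prime_gt0 (pcharf_prime hp).
have qXp : in_qpoly ('X^p : {poly k}) 'X^p = 0.
  apply: val_inj => /=; rewrite mk_monic_Xn prednK //.
  by apply: Pdiv.RingMonic.rmodpp; apply: monicXn.
have dXp : ('X^p : {poly k})^`() = 0.
  by rewrite derivXn -scaler_nat (pcharf0 hp) scale0r.
rewrite {2}(Pdiv.RingMonic.rdivp_eq (monicXn _ p) q) derivD derivM dXp mulr0.
rewrite addr0 in_qpolyD in_qpolyM qXp mulr0 add0r.
rewrite lfunE /= /truncpoly_deriv; congr (in_qpoly _ (deriv _)).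
by rewrite /= mk_monic_Xn prednK.
Qed.

Lemma wittD_derivation : p \in [pchar k] -> is_derivation wittD.
Proof.
move=> hp a b; rewrite -[a]in_truncpoly_val -[b]in_truncpoly_val -in_qpolyM.
by rewrite !wittD_in // derivM in_qpolyD !in_qpolyM.
Qed.

Lemma wittXD_in m : p \in [pchar k] -> wittXD m \in witt.
Proof.
move=> hp; apply/wittP => [|a b]; first exact: prime_gt0 (pcharf_prime hp).
by rewrite !wittXDE wittD_derivation //; ring.
Qed.

Definition witt_basis : p.-tuple 'End(A) := [tuple wittXD m | m < p].

Lemma derivation1 d : is_derivation d -> d 1 = 0.
Proof.
move=> /(_ 1 1); rewrite !mulr1 mul1r => /eqP.
by rewrite -subr_eq0 opprD addrA subrr add0r oppr_eq0 => /eqP.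
Qed.

Lemma derivation_Xn d n : is_derivation d -> d (x_ ^+ n) = n%:R *: (x_ ^+ n.-1 * d x_).
Proof.
move=> dd; elim: n => [|n IHn]; first by rewrite derivation1 // scale0r.
rewrite exprS dd IHn -scalerAr mulrA; case: n {IHn} => [|n].
  by rewrite scale0r addr0 expr0 mulrC scale1r.
by rewrite /= -exprS -[in RHS]natr1 scalerDl scale1r addrC [d x_ * _]mulrC.
Qed.

Lemma derivation_ext d d' : (0 < p)%N ->
  is_derivation d -> is_derivation d' -> d x_ = d' x_ -> d = d'.
Proof.
move=> p0 dd dd' e; apply/lfunP => a; rewrite (truncpoly_span a p0) !linear_sum.
by apply: eq_bigr => i _ /=; rewrite !linearZ /= !derivation_Xn // e.
Qed.

Lemma coef_truncpoly_sum (c : 'I_p -> k) (i : 'I_p) :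
  (val (\sum_j c j *: x_ ^+ j))`_i = c i.
Proof.
have p0 : (0 < p)%N by case: i => i; apply: leq_trans.
rewrite (eq_bigr (fun j : 'I_p => in_qpoly 'X^p (c j *: 'X^j))); last first.
  by move=> j _; rewrite linearZ /= rmorphXn.
rewrite -linear_sum /=.
have sz : (size (\sum_(j < p) c j *: ('X^j : {poly k}))%R <= p)%N.
  apply: (leq_trans (size_sum _ _ _)); apply/bigmax_leqP => j _.
  by apply: leq_trans (size_scale_leq _ _) _; rewrite size_polyXn.
rewrite mk_monic_Xn prednK // Pdiv.CommonRing.rmodp_small; last first.
  by rewrite size_polyXn ltnS.
rewrite coef_sum (bigD1 i) //= coefZ coefXn eqxx mulr1 big1 ?addr0 // => j ji.
by rewrite coefZ coefXn [_ == _ :> nat]eq_sym (inj_eq val_inj) (negPf ji) mulr0.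
Qed.

Lemma witt_basisP : p \in [pchar k] -> basis_of witt witt_basis.
Proof.
move=> hp; have p1 : (1 < p)%N := prime_gt1 (pcharf_prime hp).
have p0 := ltnW p1.
have Dx m : wittXD m x_ = x_ ^+ m.
  by rewrite wittXDE -[X in wittD X]expr1 wittD_Xn // scale1r mulr1.
have nthE (i : 'I_p) : witt_basis`_i = wittXD i by rewrite -tnth_nth tnth_mktuple.
apply/andP; split; last first.
  apply/freeP => c /(congr1 (fun f : 'End(A) => f x_)) e i.
  rewrite -(coef_truncpoly_sum c i); move: e; rewrite sum_lfunE zero_lfunE.
  rewrite (eq_bigr (fun j : 'I_p => c j *: x_ ^+ j)) => [->|j _].
    by rewrite coef0.
  by rewrite scale_lfunE nthE Dx.
rewrite eqEsubv; apply/andP; split.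
  by apply/span_subvP => _ /mapP[m _ ->]; apply: wittXD_in.
apply/subvP => d /wittP-/(_ p0) dd.
suff -> : d = \sum_(m < p) (val (d x_))`_m *: wittXD m.
  apply: memv_suml => m _; apply/memvZ/memv_span/mapP.
  by exists m; rewrite ?mem_enum.
apply: derivation_ext => //; last first.
  rewrite {1}(truncpoly_span (d x_) p0) sum_lfunE.
  by apply: eq_bigr => m _; rewrite scale_lfunE Dx.
apply/(wittP _ p0)/memv_suml => m _; exact/memvZ/wittXD_in.
Qed.

(* g_i; the summand of index m is g_[j] with j = m - 1. *)
Definition witt_filt (i : int) : {vspace 'End(A)} :=
  (\sum_(m < p | (i <= m%:Z - 1)%R) <[wittXD m]>)%VS.

Local Notation g := (subvs_of witt).

Definition lie (x y : 'End(A)) : 'End(A) := (x \o y)%VF - (y \o x)%VF.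

Definition ppow (x : 'End(A)) : 'End(A) := iter p (comp_lfun x) \1%VF.

Lemma lie_witt x y : (0 < p)%N -> x \in witt -> y \in witt -> lie x y \in witt.
Proof.
move=> p0 /(wittP _ p0) dx /(wittP _ p0) dy; apply/(wittP _ p0) => a b.
rewrite /lie !(add_lfunE, opp_lfunE, comp_lfunE) dx dy !linearD /= !dx !dy.
ring.
Qed.

Lemma iter_comp_lfunE (x : 'End(A)) n a :
  iter n (comp_lfun x) \1%VF a = iter n x a.
Proof. by elim: n => [|n IHn] /=; rewrite ?id_lfunE // comp_lfunE IHn. Qed.

Lemma ppow_witt x : p \in [pchar k] -> x \in witt -> ppow x \in witt.
Proof.
move=> hp; have p0 : (0 < p)%N := prime_gt0 (pcharf_prime hp).
move=> /(wittP _ p0) dx; apply/(wittP _ p0) => a b; rewrite !iter_comp_lfunE.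
have leib n : iter n x (a * b) =
    \sum_(i < n.+1) (iter (n - i) x a * iter i x b) *+ 'C(n, i).
  elim: n => [|n IHn]; first by rewrite big_ord1 /= mulr1n.
  rewrite iterS IHn linear_sum /=.
  rewrite (eq_bigr (fun i : 'I_n.+1 =>
    (iter (n.+1 - i) x a * iter i x b) *+ 'C(n, i) +
    (iter (n - i) x a * iter i.+1 x b) *+ 'C(n, i))); last first.
    by move=> i _; rewrite linearMn /= dx mulrnDl subSn // -ltnS.
  rewrite big_split /= big_ord_recl [in RHS]big_ord_recl !bin0 -addrA.
  congr (_ + _); rewrite [X in _ = X](eq_bigr (fun i : 'I_n.+1 =>
    (iter (n - i) x a * iter i.+1 x b) *+ 'C(n, i.+1) +
    (iter (n - i) x a * iter i.+1 x b) *+ 'C(n, i))); last first.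
    by move=> i _; rewrite /= subSS binS mulrnDr.
  rewrite big_split /=; congr (_ + _).
  rewrite [in RHS]big_ord_recr /= bin_small // mulr0n addr0.
  by apply: eq_bigr => i _; rewrite /= subSS.
rewrite leib (bigD1 ord0) //= (bigD1 ord_max) /=; last first.
  by rewrite -val_eqE /= -lt0n.
rewrite subn0 subnn bin0 binn /= !mulr1n big1 ?addr0 // => i /andP[i0 ip].
have hpA : p \in [pchar A] by rewrite pchar_qpoly.
rewrite -mulr_natr.
have /dvdnP[q ->] : (p %| 'C(p, i))%N.
  apply: prime_dvd_bin; first exact: pcharf_prime hp.
  by move: i0 ip; rewrite -!val_eqE /= lt0n ltn_neqAle => -> -> /=; rewrite -ltnS.
by rewrite natrM (pcharf0 hpA) !mulr0.
Qed.

Local Open Scope classical_set_scope.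

Definition nil_set : set g := [set x | ppow (val x) = 0].

Definition nil_borel : set g :=
  [set x | val x \in witt_filt 0 /\ nil_set x].

Definition commuting_g1 : set (g * g) :=
  [set z | [/\ val z.1 \in witt_filt 1, val z.2 \in witt_filt 1 &
               lie (val z.1) (val z.2) = 0]].

Definition frakC (i : nat) : set (g * g) :=
  zclosure [set z | [/\ nil_set z.1, nil_set z.2,
                        val z.1 \in witt_filt i%:Z,
                        val z.1 \notin witt_filt (i%:Z + 1) &
                        lie (val z.1) (val z.2) = 0]].

End Witt.

Arguments nil_set : clear implicits.
Arguments nil_borel : clear implicits.
Arguments commuting_g1 : clear implicits.
Arguments frakC : clear implicits.

(* Main.v *)
From HB Require Import structures.
Require Import Defs.
From mathcomp Require Import all_boot all_order all_algebra ring zify.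
From mathcomp Require Import mpoly boolp classical_sets.

Set Implicit Arguments.
Unset Strict Implicit.
Unset Printing Implicit Defensive.

Import GRing.Theory.
Local Open Scope classical_set_scope.
Local Open Scope ring_scope.

(** An element [x = a(X) D] of the Witt algebra is determined by the truncated
    polynomial [a], and the bracket of [a D] and [b D] is [w D] for the
    Wronskian [w = a b' - a' b].  If [a] starts in degree [s] and [b] in degree
    [m], then [w] starts in degree [s + m - 1] with coefficient
    [(m - s) a_s b_m], which is nonzero as long as [m] and [s] are distinct and
    below [p].  Hence, for [x] in g_i but not in g_(i+1) with [1 <= i], the
    elements commuting with [x] are the [c x + w] with [w] in g_(p-1-i)
    ([wronskian_lowest], [commute_lowest]).

    For [1 <= i <= (p-3)/2] the pairs [(x, c x + w)] with [x] in g_i and [w] in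
    g_(p-1-i) form the image of an affine space of dimension
    [(p-1-i) + 1 + i = p] under a polynomial map.  Letting [x] degenerate to
    g_(i+1) along a line shows that C(i) is the closure of this image
    ([frakCE], [range_param]), so C(i) is irreducible.

    The C(i) cover the commuting variety ([commuting_decomposition]): with
    [e = (p-3)/2], a commuting pair [(x, y)] with [x] outside g_(e+2) lies in
    one of the images; if [x] is in g_(e+2) and [y] is not, then [(x, y)] is
    the limit of the pairs [(x + t y, y)], which were just treated; and a pair
    of elements of g_(e+2) = g_(p-1-e) is of the form [(x, 0 x + w)] for
    [i = e].  No C(i) lies in another C(j) ([frakC_sub_inj]): for [i < j]
    because C(j) lies in g_j x g_j, and for [j < i] because a 2 x 2 minor of the
    coefficients of [x] and [y] vanishes on C(j) but not on C(i).

    The dimension is computed from chains of closed irreducible sets.  A chain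
    of length [n] yields [n] algebraically independent functions on its last
    member ([zchain_alg_independent]), and there are at most [p] of those on the
    image of an affine space of dimension [p], because more than [p] polynomials
    in [p] variables are algebraically dependent ([mpoly_dependent]).
    Conversely, g_i x g_(p-1-i) is a linear subspace of dimension [p-1] properly
    contained in C(i), and a full flag in it followed by C(i) is a chain of
    length [p] ([frakC_chain]). *)

(** * Regular functions and closed sets *)

Definition regular (k : fieldType) (V : vectType k) (f : V -> k) : Prop :=
  exists P : {mpoly k[\dim {:V}]}, forall v, f v = P.@[zcoord v].

Definition regmap (k : fieldType) (W V : vectType k) (phi : W -> V) : Prop :=
  forall i, regular (fun w => zcoord (phi w) i).

Section Regular.
Variables (k : fieldType) (V : vectType k).
Implicit Types (f g : V -> k) (F G : set V).

Lemma regular_cst c : regular (fun _ : V => c).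
Proof. by exists c%:MP => v; rewrite mevalC. Qed.

Lemma regularD f g : regular f -> regular g -> regular (fun v => f v + g v).
Proof. by move=> [P fP] [Q gQ]; exists (P + Q) => v; rewrite mevalD fP gQ. Qed.

Lemma regularM f g : regular f -> regular g -> regular (fun v => f v * g v).
Proof. by move=> [P fP] [Q gQ]; exists (P * Q) => v; rewrite mevalM fP gQ. Qed.

Lemma regularB f g : regular f -> regular g -> regular (fun v => f v - g v).
Proof. by move=> [P fP] [Q gQ]; exists (P - Q) => v; rewrite mevalB fP gQ. Qed.

Lemma regular_sum n (f : 'I_n -> V -> k) :
  (forall i, regular (f i)) -> regular (fun v => \sum_i f i v).
Proof.
move=> /choice[P fP]; exists (\sum_i P i) => v.
by rewrite raddf_sum; apply: eq_bigr => i _; apply: fP.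
Qed.

Lemma regularX f n : regular f -> regular (fun v => f v ^+ n).
Proof. by move=> [P fP]; exists (P ^+ n) => v; rewrite rmorphXn /= fP. Qed.

Lemma regular_meval n (P : {mpoly k[n]}) (f : 'I_n -> V -> k) :
  (forall i, regular (f i)) -> regular (fun v => P.@[fun i => f i v]).
Proof.
move=> /choice[Q fQ]; exists (P \mPo [tuple Q i | i < n]) => v.
rewrite comp_mpoly_meval; apply: meval_eq => i.
by rewrite tnth_mktuple fQ.
Qed.

Lemma regular_scalar f : scalar f -> regular f.
Proof.
move=> lf.
pose fL := HB.pack f (GRing.isLinear.Build _ _ _ _ f lf) : {scalar V}.
exists (\sum_(i < \dim {:V}) f ((vbasis {:V})`_i) *: 'X_i) => v.
rewrite -[LHS]/(fL v) {1}(coord_vbasis (memvf v)) linear_sum raddf_sum /=.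
by apply: eq_bigr => i _; rewrite mevalZ mevalXU mulrC; apply: (scalarZ fL).
Qed.

(** Closed sets are handled only through this separation property, which speaks
    of functions instead of sets of polynomials in coordinates. *)
Lemma zclosedP F : zclosed F <->
  forall v, ~ F v -> exists f,
    [/\ regular f, forall w, F w -> f w = 0 & f v != 0].
Proof.
split=> [[I ->] v /existsNP[P /not_implyP[IP /eqP Pv]]|sep].
  by exists (fun v => P.@[zcoord v]); split=> // [|w]; [exists P | apply].
exists [set P | forall w, F w -> P.@[zcoord w] = 0].
apply/seteqP; split=> [v Fv P|v Iv]; first by apply.
apply: contrapT => /sep[f [[P fP] f0]]; rewrite fP Iv ?eqxx // => w /f0.
by rewrite fP.
Qed.

Lemma zclosed_zeros (I : Type) (D : set I) (f : I -> V -> k) :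
  (forall i, D i -> regular (f i)) ->
  zclosed [set v | forall i, D i -> f i v = 0].
Proof.
move=> rf; apply/zclosedP => v /existsNP[i /not_implyP[Di /eqP fi]].
by exists (f i); split=> //; [apply: rf | move=> w; apply].
Qed.

Lemma zclosed_zero f : regular f -> zclosed [set v | f v = 0].
Proof. by move=> rf; apply/zclosedP => v /eqP fv; exists f. Qed.

Lemma zclosed0 : zclosed (@set0 V).
Proof.
apply/zclosedP => v _; exists (fun=> 1); split=> //; first exact: regular_cst.
exact: oner_neq0.
Qed.

Lemma zclosedU F G : zclosed F -> zclosed G -> zclosed (F `|` G).
Proof.
move=> /zclosedP cF /zclosedP cG; apply/zclosedP => v /not_orP[/cF + /cG].
move=> [f [rf f0 fv]] [g [rg g0 gv]]; exists (fun v => f v * g v).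
split; [exact: regularM | | by rewrite mulf_neq0].
by move=> w [/f0|/g0] ->; rewrite (mul0r, mulr0).
Qed.

Lemma zclosedI F G : zclosed F -> zclosed G -> zclosed (F `&` G).
Proof.
move=> /zclosedP cF /zclosedP cG; apply/zclosedP => v /not_andP[/cF|/cG].
  by move=> [f [rf f0 fv]]; exists f; split=> // w [/f0].
by move=> [f [rf f0 fv]]; exists f; split=> // w [_ /f0].
Qed.

Lemma zclosed_bigcup n (D : pred nat) (F : nat -> set V) :
  (forall i, D i -> (i < n)%N) -> (forall i, D i -> zclosed (F i)) ->
  zclosed (\bigcup_(i in [set i | D i]) F i).
Proof.
elim: n D => [|n IHn] D Dn cF.
  rewrite (_ : \bigcup_(i in _) _ = set0) ?predeqE; first exact: zclosed0.
  by move=> v; split=> // -[i /= /Dn].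
have cFn : zclosed (if D n then F n else set0).
  by case: ifP => [/cF //|_]; apply: zclosed0.
have := zclosedU (IHn [pred i | D i & (i < n)%N] _ _) cFn.
move=> /(_ (fun i h => proj2 (andP h)) (fun i h => cF i (proj1 (andP h)))).
congr (zclosed _); apply/seteqP; split=> v.
  case=> [[i /andP[Di _] Fi]|]; first by exists i.
  by case: ifP => // Dn' Fn; exists n.
move=> [i /= Di Fi]; have := Dn i Di.
rewrite ltnS leq_eqVlt => /orP[/eqP ei|li].
  by right; rewrite -ei Di.
by left; exists i => //=; apply/andP.
Qed.

Lemma zclosure_closed F : zclosed (zclosure F).
Proof.
apply/zclosedP => v /existsNP[G /not_implyP[cG /not_implyP[FG nGv]]].
have /zclosedP/(_ v nGv)[f [rf f0 fv]] := cG.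
by exists f; split=> // w /(_ G cG FG)/f0.
Qed.

Lemma zclosure_subset F : F `<=` zclosure F.
Proof. by move=> v Fv G _; apply. Qed.

Lemma zclosure_min F G : zclosed G -> F `<=` G -> zclosure F `<=` G.
Proof. by move=> cG FG v; apply. Qed.

Lemma zirreducible_closure F : zirreducible F -> zirreducible (zclosure F).
Proof.
move=> [[v Fv] irrF]; split; first by exists v; apply: zclosure_subset.
move=> G H cG cH GH.
have [FG|FH] := irrF G H cG cH (subset_trans (@zclosure_subset F) GH).
  by left; apply: zclosure_min.
by right; apply: zclosure_min.
Qed.

(** Iterating the definition of irreducibility over a finite union of closed
    sets; the largest index is split off first. *)
Lemma zirreducible_bigcup n (D : pred nat) (F : nat -> set V) (Z : set V) :
  (forall i, D i -> (i < n)%N) -> (forall i, D i -> zclosed (F i)) ->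
  zirreducible Z -> Z `<=` \bigcup_(i in [set i | D i]) F i ->
  exists2 i, D i & Z `<=` F i.
Proof.
move=> + + [[z Zz] irrZ]; elim: n D => [|n IHn] D Dn cF ZF.
  by have [i /= /Dn] := ZF z Zz.
pose D' := [pred i | D i & (i < n)%N].
have D'n i : D' i -> (i < n)%N by case/andP.
have cF' i : D' i -> zclosed (F i) by case/andP => /cF.
have cFn : zclosed (if D n then F n else set0).
  by case: ifP => [/cF //|_]; apply: zclosed0.
have [|ZF'|ZFn] := irrZ _ _ (zclosed_bigcup D'n cF') cFn.
- move=> v /ZF[i /= Di Fi]; have := Dn i Di.
  rewrite ltnS leq_eqVlt => /orP[/eqP ei|li]; first by right; rewrite -ei Di.
  by left; exists i => //=; apply/andP.
- by have [i /andP[Di _] ZFi] := IHn D' D'n cF' ZF'; exists i.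
- by move: ZFn; case: ifP => [Dn' ZFn|_ /(_ z Zz) //]; exists n.
Qed.

(** An irreducible subset of a finite union of closed sets lies in one of them,
    so maximal irreducible subsets are found among irredundant irreducible
    pieces. *)
Lemma zcomponent_bigcup n (D : pred nat) (F : nat -> set V) (S Z : set V) :
  (forall i, D i -> (i < n)%N) -> (forall i, D i -> zclosed (F i)) ->
  (forall i, D i -> zirreducible (F i)) ->
  (forall i j, D i -> D j -> F i `<=` F j -> i = j) ->
  S = \bigcup_(i in [set i | D i]) F i ->
  zcomponent S Z <-> exists2 i, D i & Z = F i.
Proof.
move=> Dn clF irrF injF eS.
have FS i : D i -> F i `<=` S by move=> Di v Fv; rewrite eS; exists i.
split=> [[ZS irrZ maxZ]|[i Di ->]].
  rewrite eS in ZS; have [i Di ZF] := zirreducible_bigcup Dn clF irrZ ZS.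
  by exists i => //; rewrite (maxZ (F i)) //; [apply: FS | apply: irrF].
split; [exact: FS | exact: irrF | move=> Z' Z'S irrZ' FZ'].
rewrite eS in Z'S; have [j Dj ZF] := zirreducible_bigcup Dn clF irrZ' Z'S.
have eij := injF i j Di Dj (subset_trans FZ' ZF); rewrite -eij in ZF.
by apply/seteqP; split.
Qed.

End Regular.

Section Regmap.
Variables (k : fieldType) (W V : vectType k).
Implicit Types (phi psi : W -> V).

Lemma regular_comp f phi : regular f -> regmap phi -> regular (f \o phi).
Proof.
move=> [P fP] rphi; have [Q eQ] := regular_meval P rphi.
by exists Q => w; rewrite /= fP -eQ.
Qed.

Lemma regmap_linear phi : linear phi -> regmap phi.
Proof.
by move=> lphi i; apply: regular_scalar => a u v; rewrite /zcoord lphi linearP.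
Qed.

Lemma regmapD phi psi :
  regmap phi -> regmap psi -> regmap (fun w => phi w + psi w).
Proof.
move=> rphi rpsi i; have [P eP] := regularD (rphi i) (rpsi i).
by exists P => w; rewrite -eP /zcoord linearD.
Qed.

Lemma regmapZ f phi : regular f -> regmap phi -> regmap (fun w => f w *: phi w).
Proof.
move=> rf rphi i; have [P eP] := regularM rf (rphi i).
by exists P => w; rewrite -eP /zcoord linearZ.
Qed.

Lemma regmap_cst (v : V) : regmap (fun _ : W => v).
Proof. by move=> i; apply: regular_cst. Qed.

End Regmap.

(** The multivariate polynomial in the single coordinate of the line is made
    univariate by substituting multiples of the variable: the fixed basis of
    [k^o] need not be [1]. *)
Lemma regular_poly (k : fieldType) (f : k^o -> k) :
  regular f -> exists q : {poly k}, forall t, f t = q.[t].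
Proof.
move=> [P fP]; pose h i : {poly k} := zcoord (1 : k^o) i *: 'X.
exists (mmap polyC h P) => t; rewrite fP.
have -> : zcoord t = fun i => (h i).[t].
  apply/funext => i; rewrite hornerZ hornerX.
  by rewrite -[in LHS](mulr1 t) /zcoord [t * 1]/(t *: (1 : k^o)) linearZ mulrC.
rewrite /meval /mmap horner_sum.
apply: eq_bigr => m _; rewrite hornerM hornerC; congr (_ * _).
by rewrite /mmap1 horner_prod; apply: eq_bigr => i _; rewrite horner_exp.
Qed.

(** * Algebraically dependent polynomials *)

Section Muni.
Variables (R : nzRingType) (n : nat).
Implicit Types (P : {mpoly R[n.+1]}).
Local Notation widen := (widen_ord (leqnSn n)).

(** [muni] views a polynomial as univariate in its last variable; it only
    regroups the monomials, so each of them can be recovered. *)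
Lemma muni_eq0 P : muni P = 0 -> P = 0.
Proof.
move=> P0; apply/eqP; rewrite -msupp_eq0; case E: (msupp P) => [//|m0 s].
have m0P : m0 \in msupp P by rewrite E mem_head.
pose lo (m : 'X_{1..n.+1}) := [multinom m (widen i) | i < n].
have := congr1 (fun q : {poly {mpoly R[n]}} => (q`_(m0 ord_max))@_(lo m0)) P0.
rewrite coef0 mcoeff0 muniE coef_sum raddf_sum (bigD1_seq m0) //= big1 ?addr0.
  rewrite coefZ coefXn eqxx mulr1 mcoeffZ mcoeffX eqxx mulr1 => /eqP.
  by rewrite mcoeff_eq0 m0P.
move=> m m_m0; rewrite coefZ coefXn mulr_natr mcoeffMn mcoeffZ mcoeffX.
case: (eqVneq (lo m) (lo m0)) => [e|]; last by rewrite mulr0 mul0rn.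
case: eqP => // e'; case/eqP: m_m0; apply/mnmP => i.
have [j ->|->] := unliftP ord_max i; last by [].
have := congr1 (fun m : 'X_{1..n} => m j) e; rewrite !mnmE.
by congr (_ = _); congr (_ _); apply/val_inj; rewrite /= /bump leqNgt ltn_ord.
Qed.
End Muni.

Lemma muni_meval (R : comNzRingType) n (P : {mpoly R[n.+1]})
    (u : 'I_n.+1 -> R) :
  P.@[u] = (map_poly (meval (fun i => u (widen_ord (leqnSn n) i)))
                     (muni P)).[u ord_max].
Proof.
rewrite mevalE muniE raddf_sum horner_sum; apply: eq_bigr => m _ /=.
rewrite map_polyZ map_polyXn hornerZ hornerXn [X in _ = X * _]mevalZ mevalX.
rewrite big_ord_recr /= mulrA.
by congr (_ * _ * _); apply: eq_bigr => i _; rewrite mnmE.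
Qed.

Section MsizeBound.
Variables (k : fieldType) (m : nat).
Implicit Types (f g : {mpoly k[m]}).

Lemma msizeM_bound f g a b : (msize f <= a.+1)%N -> (msize g <= b.+1)%N ->
  (msize (f * g) <= (a + b).+1)%N.
Proof.
have [->|f0] := eqVneq f 0; first by rewrite mul0r msize0.
have [->|g0] := eqVneq g 0; first by rewrite mulr0 msize0.
move=> fa gb; rewrite msizeM //.
by have := leq_add fa gb; rewrite addSn addnS; case: (_ + _)%N => // -[].
Qed.

Lemma msizeX_bound f a e :
  (msize f <= a.+1)%N -> (msize (f ^+ e) <= (e * a).+1)%N.
Proof.
move=> fa; elim: e => [|e IHe]; first by rewrite expr0 msize1.
by rewrite exprS mulSn; apply: msizeM_bound.
Qed.

Lemma msize_prod_bound n (f : 'I_n -> {mpoly k[m]}) a :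
  (forall i, (msize (f i) <= a.+1)%N) -> (msize (\prod_i f i) <= (n * a).+1)%N.
Proof.
elim: n f => [|n IHn] f fa; first by rewrite big_ord0 msize1.
by rewrite big_ord_recl mulSn; apply: msizeM_bound => //; apply: IHn => i.
Qed.
End MsizeBound.

(** Counting: the [N ^ n] monomials with exponents below [N] in the [n] given
    polynomials are polynomials of degree less than [N * C] in [m] variables,
    hence live in a space of dimension at most [(N * C) ^ m], where [C] does not
    depend on [N].  As [m < n], a large [N] forces a linear relation. *)
Lemma mpoly_dependent (k : fieldType) m n (f : 'I_n -> {mpoly k[m]}) :
  (m < n)%N ->
  exists2 P : {mpoly k[n]}, P != 0 & forall u, P.@[fun i => (f i).@[u]] = 0.
Proof.
move=> mn; pose D := \max_i msize (f i); pose C := (n * D).+1.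
(* This is the least N with (N * C) ^ m < N ^ m.+1. *)
pose N := (C ^ m).+1; pose B := (N * C)%N.
pose mon q b (e : {ffun 'I_q -> 'I_b}) := [multinom e i : nat | i < q].
pose g (e : {ffun 'I_n -> 'I_N}) := \prod_i f i ^+ e i.
have gB e : (msize (g e) <= B)%N.
  have fD i : (msize (f i) <= D.+1)%N.
    by apply/leqW; apply: (leq_bigmax (F := fun i => msize (f i))).
  apply: leq_trans (msize_prod_bound (a := C ^ m * D) _) _ => [i|].
    apply: leq_trans (msizeX_bound _ (fD i)) _.
    by rewrite ltnS leq_mul2r -ltnS ltn_ord orbT.
  rewrite /B /N mulSn -[X in (X <= _)%N]add1n; apply: leq_add => //.
  by rewrite mulnCA leq_mul2l leqnSn orbT.
pose A := \matrix_(i < #|{ffun 'I_n -> 'I_N}|, j < #|{ffun 'I_m -> 'I_B}|)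
   (g (enum_val i))@_(mon _ _ (enum_val j)).
have : kermx A != 0.
  rewrite -mxrank_eq0 mxrank_ker subn_eq0 -ltnNge.
  apply: leq_ltn_trans (rank_leq_col _) _; rewrite !card_ffun !card_ord.
  apply: leq_trans (leq_pexp2l _ mn) => //.
  by rewrite /B expnMn expnS mulnC ltn_pmul2r ?ltnS // expn_gt0.
case/rowV0Pn => c /sub_kermxP cA c0.
pose P := \sum_(e : {ffun 'I_n -> 'I_N}) c 0 (enum_rank e) *: 'X_[k, mon _ _ e].
have Pe e : P@_(mon _ _ e) = c 0 (enum_rank e).
  rewrite raddf_sum (bigD1 e) //= mcoeffZ mcoeffX eqxx mulr1 big1 ?addr0 //.
  move=> e' ee'; rewrite mcoeffZ mcoeffX; case: eqP; last by rewrite mulr0.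
  move=> /mnmP eqm; case/eqP: ee'; apply/ffunP => i; apply/val_inj.
  by have := eqm i; rewrite !mnmE.
exists P.
  apply: contra_neq c0 => P0; apply/rowP => i.
  by rewrite -(enum_valK i) -Pe P0 mcoeff0 mxE.
have gc0 : \sum_e c 0 (enum_rank e) *: g e = 0.
  apply/mpolyP => mu; rewrite mcoeff0 raddf_sum /=.
  have [muB|muB] := ltnP (mdeg mu) B; last first.
    rewrite big1 // => e _; rewrite mcoeffZ memN_msupp_eq0 ?mulr0 //.
    by apply: msize_mdeg_ge; apply: leq_trans (gB e) muB.
  have mui i : (mu i < B)%N.
    by apply: leq_ltn_trans muB; rewrite mdegE (bigD1 i) //= leq_addr.
  pose a : {ffun 'I_m -> 'I_B} := [ffun i => Ordinal (mui i)].
  have -> : mu = mon _ _ a by apply/mnmP => i; rewrite mnmE ffunE.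
  have := congr1 (fun M : 'rV_ _ => M 0 (enum_rank a)) cA; rewrite !mxE => e0.
  rewrite -[RHS]e0 {e0}.
  rewrite [RHS](reindex enum_rank) /=; last first.
    by apply: onW_bij; apply: enum_rank_bij.
  by apply: eq_bigr => e _; rewrite mcoeffZ !mxE !enum_rankK.
move=> u; have := congr1 (meval u) gc0; rewrite meval0 => e0; rewrite -[RHS]e0.
rewrite !raddf_sum /=; apply: eq_bigr => e _; rewrite !mevalZ mevalX.
congr (_ * _).
by rewrite rmorph_prod /=; apply: eq_bigr => i _; rewrite mnmE rmorphXn.
Qed.

(** * Curves and images of polynomial maps *)

Section ClosedField.
Variables (k : closedFieldType).

Lemma poly_zero (q : {poly k}) : (forall t, q.[t] = 0) -> q = 0.
Proof.
move=> q0; apply/eqP; apply: contraT => /closed_nonrootP[t].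
by rewrite /root q0 eqxx.
Qed.

(** Limits along a polynomial curve stay in a closed set, because a polynomial
    vanishing at all nonzero points of an infinite field is zero.  All
    degenerations below are obtained in this way. *)
Lemma zclosed_curve (V : vectType k) (F : set V) (h : k^o -> V) :
  zclosed F -> regmap h -> (forall t, t != 0 -> F (h t)) -> F (h 0).
Proof.
move=> /zclosedP cF rh Fh; apply: contrapT => /cF[f [rf f0 /eqP]]; apply.
have [q fq] := regular_poly (regular_comp rf rh).
have q0 t : t != 0 -> q.[t] = 0 by move=> /Fh/f0; rewrite -fq.
have /poly_zero/eqP : forall t, (q * 'X).[t] = 0.
  move=> t; rewrite hornerMX.
  have [->|/q0 ->] := eqVneq t 0; first by rewrite mulr0.
  by rewrite mul0r.
rewrite mulf_eq0 polyX_eq0 orbF => /eqP q_eq0.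
by have /= -> := fq 0; rewrite q_eq0 horner0.
Qed.

Lemma regmap_line (V : vectType k) (a b : V) :
  regmap (fun t : k^o => a + t *: b).
Proof.
apply: regmapD; first exact: regmap_cst.
by apply: regmap_linear => c t u; rewrite scalerDl scalerA.
Qed.

(** Restricting to the line through two parameters reduces the claim to the
    fact that univariate polynomials over an infinite field have no zero
    divisors, even when they are regarded as functions. *)
Lemma zirreducible_image (W V : vectType k) (phi : W -> V) :
  regmap phi -> zirreducible (range phi).
Proof.
move=> rphi; split; first by exists (phi 0); exists 0.
move=> F G cF cG FG; apply: contrapT => /not_orP[].
move=> /existsNP[_ /not_implyP[[w1 _ <-] nF]].
move=> /existsNP[_ /not_implyP[[w2 _ <-] nG]].
have /zclosedP/(_ _ nF)[f [rf f0 fw1]] := cF.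
have /zclosedP/(_ _ nG)[g [rg g0 gw2]] := cG.
have rl := regmap_line w1 (w2 - w1).
have [q1 e1] := regular_poly (regular_comp (regular_comp rf rphi) rl).
have [q2 e2] := regular_poly (regular_comp (regular_comp rg rphi) rl).
have /poly_zero/eqP : forall t, (q1 * q2).[t] = 0.
  move=> t; rewrite hornerM -e1 -e2 /=.
  have /FG[/f0 ->|/g0 ->] : range phi (phi (w1 + t *: (w2 - w1))).
    by exists (w1 + t *: (w2 - w1)).
    by rewrite mul0r.
  by rewrite mulr0.
rewrite mulf_eq0 => /orP[]/eqP q0.
  move: (e1 0) fw1; rewrite q0 horner0 /= scale0r addr0 => ->.
  by rewrite eqxx.
move: (e2 1) gw2; rewrite q0 horner0 /= scale1r addrC subrK => ->.
by rewrite eqxx.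
Qed.

End ClosedField.

(** * Lengths of chains *)

Section Chains.
Variables (k : fieldType) (V : vectType k).
Implicit Types (S Z F : set V).

(** The family is indexed by [nat] rather than ['I_n] so that it can be extended
    by one more function without casting indices. *)
Definition alg_independent S n (f : nat -> V -> k) : Prop :=
  forall P : {mpoly k[n]}, (forall v, S v -> P.@[fun i => f i v] = 0) -> P = 0.

(** Write a relation between [f] and [g] on [F] as [g ^ m * Q(f, g)] with
    [Q(f, 0)] a nonzero polynomial in [f].  Since [g] is not zero on the
    irreducible set [F], already [Q(f, g)] vanishes on [F]; restricting to [Z],
    where [g] vanishes, gives the relation [Q(f, 0)] among the [f]. *)
Lemma alg_independent_extend Z F n (f : nat -> V -> k) (g : V -> k) :
  zirreducible F -> Z `<=` F -> (forall i, regular (f i)) -> regular g ->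
  (forall v, Z v -> g v = 0) -> (exists2 v, F v & g v != 0) ->
  alg_independent Z n f ->
  alg_independent F n.+1 (fun i => if (i < n)%N then f i else g).
Proof.
move=> [_ irrF] ZF rf rg gZ [v0 Fv0 gv0] indZ P PF.
apply: muni_eq0; apply/eqP; apply: contraT => P0.
have [m [q]] := multiplicity_XsubC (muni P) 0.
rewrite P0 subr0 => /negP nq0 eP; case: nq0; apply/eqP.
pose ev v := meval (fun i : 'I_n => f i v).
have evP v : F v -> (map_poly (ev v) q).[g v] * g v ^+ m = 0.
  move/PF; rewrite muni_meval /= ltnn (_ : meval _ = ev v) ?eP.
    by rewrite rmorphM rmorphXn /= map_polyX hornerM hornerXn.
  by congr (meval _); apply/funext => i; rewrite /= ltn_ord.
pose h v := (map_poly (ev v) q).[g v].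
have rh : regular h.
  have -> : h = fun v =>
      \sum_(i < size q) (q`_i).@[fun i : 'I_n => f i v] * g v ^+ i.
    apply/funext => v; rewrite /h (horner_coef_wide _ (size_poly _ _)).
    by apply: eq_bigr => i _; rewrite coef_map.
  apply: regular_sum => i; apply: regularM; last exact: regularX.
  by apply: regular_meval => j; apply: rf.
have [v Fv||hF] := irrF _ _ (zclosed_zero rh) (zclosed_zero rg).
- case: (eqVneq (g v) 0) => [gv|gv]; first by right.
  left; have /eqP := evP v Fv.
  by rewrite mulf_eq0 expf_eq0 (negPf gv) andbF orbF => /eqP.
- move=> hF; apply: indZ => v Zv; have := hF v (ZF v Zv).
  by rewrite /= /h gZ // -[X in _.[X]](rmorph0 (ev v)) horner_map.
- by move/eqP: gv0; case; apply: hF.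
Qed.

(** Each step of the chain provides a function vanishing on the smaller set but
    not on the larger one, which is added to the independent family. *)
Lemma zchain_alg_independent S n (Z : nat -> set V) : zchain S n Z ->
  exists2 f : nat -> V -> k,
    forall i, regular (f i) & alg_independent (Z n) n f.
Proof.
elim: n => [|n IHn] [cZ ltZ].
  have [_ [[v Zv] _] _] := cZ 0 (leqnn 0).
  exists (fun _ _ => 0) => [i|P PZ]; first exact: regular_cst.
  have eP := @msize1_polyC 0 k P.
  have mP : (msize P <= 1)%N.
    rewrite msizeE; apply/bigmax_leqP_seq => m _ _.
    by rewrite mdegE big_ord0.
  have := PZ v Zv; rewrite (eP mP) mevalC => ->; exact: mpolyC0.
have [|f rf indf] := IHn.
  by split=> i ?; [apply/cZ/leqW | apply/ltZ/leqW].
have [ZF nFZ] := ltZ n (leqnn _); have [clZ _ _] := cZ n (leqnSn n).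
have [_ irrF _] := cZ n.+1 (leqnn _).
move: nFZ => /existsNP[v /not_implyP[Fv nZv]].
have /zclosedP/(_ v nZv)[g [rg gZ gv]] := clZ.
exists (fun i => if (i < n)%N then f i else g) => [i|]; first by case: ifP.
by apply: alg_independent_extend indf => //; exists v.
Qed.

End Chains.

(** Functions independent on the closure of the image of [phi] stay independent
    after composition with [phi], where [mpoly_dependent] bounds their
    number. *)
Lemma zchain_image_bound (k : fieldType) (W V : vectType k) (phi : W -> V)
    (S : set V) n Z :
  regmap phi -> zchain S n Z -> Z n `<=` zclosure (range phi) ->
  (n <= \dim {:W})%N.
Proof.
move=> rphi chZ Zphi; have [f rf indf] := zchain_alg_independent chZ.
rewrite leqNgt; apply/negP => ltn.
have /choice[Q fQ] : forall i, exists P : {mpoly k[\dim {:W}]},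
    forall w, f i (phi w) = P.@[zcoord w].
  by move=> i; have [P fP] := regular_comp (rf i) rphi; exists P.
have [P /eqP P0 PQ] := mpoly_dependent (fun i : 'I_n => Q i) ltn.
have cP := zclosed_zero (regular_meval P (fun i : 'I_n => rf i)).
apply/P0/indf => v /Zphi; apply: (zclosure_min cP).
move=> _ [w _ <-] /=; rewrite -[RHS](PQ (zcoord w)).
by apply: meval_eq => i; apply: fQ.
Qed.

(** * Flags of subspaces *)

Lemma zclosed_vspace (k : fieldType) (V : vectType k) (U : {vspace V}) :
  zclosed [set v | v \in U].
Proof.
pose f i v := zcoord (v - projv U v) i.
have rf i : setT i -> regular (f i).
  move=> _; apply: regular_scalar => a u v.
  by rewrite /f /zcoord linearP opprD addrACA -scalerBr linearP.
suff -> : [set v | v \in U] = [set v | forall i, setT i -> f i v = 0].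
  exact: zclosed_zeros.
apply/seteqP; split=> v /= => [vU i _|fv].
  by rewrite /f projv_id // subrr /zcoord linear0.
suff /eqP : v - projv U v = 0 by rewrite subr_eq0 => /eqP ->; apply: memv_proj.
rewrite (coord_vbasis (memvf (v - projv U v))) big1 // => i _.
by rewrite -/(zcoord _ i) [zcoord _ _](fv i) // scale0r.
Qed.

Section Flags.
Variables (k : closedFieldType) (V : vectType k).
Implicit Types (U : {vspace V}) (F S : set V).

Lemma zirreducible_vspace U : zirreducible [set v | v \in U].
Proof.
have -> : [set v | v \in U] = range (projv U).
  apply/seteqP; split=> [v /= vU|_ [v _ <-]]; last exact: memv_proj.
  by exists v; rewrite ?projv_id.
by apply/zirreducible_image/regmap_linear => a u v; rewrite linearP.
Qed.

(** The spans of the initial segments of a basis of [U], followed by [F]. *)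
Lemma zchain_flag U F S v : zclosed F -> zirreducible F -> F `<=` S ->
  [set u | u \in U] `<=` F -> F v -> v \notin U ->
  exists Z, zchain S (\dim U).+1 Z.
Proof.
move=> clF irrF FS UF Fv vU; pose X j := <<take j (vbasis U)>>%VS.
have XU j : (X j <= U)%VS.
  by apply/span_subvP => u /mem_take; apply: vbasis_mem.
have dimX j : (j <= \dim U)%N -> \dim (X j) = j.
  move=> jU; have /catl_free : free (take j (vbasis U) ++ drop j (vbasis U)).
    by rewrite cat_take_drop; apply/basis_free/vbasisP.
  by rewrite /free size_takel ?size_tuple // => /eqP.
exists (fun j => if (j <= \dim U)%N then [set u | u \in X j] else F).
split=> j jU.
  case: ifP => _; last by split.
  split; [exact: zclosed_vspace | exact: zirreducible_vspace |].
  by move=> u /= /(subvP (XU j))/UF/FS.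
rewrite -ltnS jU; case: ifP => jU'; last first.
  split=> [u /= /(subvP (XU j))/UF //|/(_ v Fv) /= /(subvP (XU j)) vU'].
  by rewrite vU' in vU.
split=> [u /=|sX].
  rewrite /X (take_nth 0) ?size_tuple //; apply/subvP/span_subvP => w wj.
  by rewrite memv_span // mem_rcons inE wj orbT.
have /dimvS : (X j.+1 <= X j)%VS by apply/subvP => u; apply: sX.
by rewrite !dimX // ltnn.
Qed.

End Flags.

(** * Wronskians and orders of vanishing *)

Lemma poly_order_ge (R : nzRingType) n (f : {poly R}) :
  (forall m, (m < n)%N -> f`_m = 0) -> exists q, f = q * 'X^n.
Proof.
move=> f0; exists (drop_poly n f); rewrite -[LHS](poly_take_drop n).
suff -> : take_poly n f = 0 by rewrite add0r.
by apply/polyP => m; rewrite coef_take_poly coef0; case: ifP => // /f0.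
Qed.

(** The factor ['X] avoids the truncated exponent [n.-1] of the derivative of
    ['X^n]. *)
Lemma mulX_derivMXn (R : comNzRingType) n (q : {poly R}) :
  'X * (q * 'X^n)^`() = (n%:R *: q + 'X * q^`()) * 'X^n.
Proof.
rewrite derivM derivXn mulrDr mulrDl addrC mulrA.
congr (_ + _); last by rewrite mulrA.
case: n => [|n]; first by rewrite mulr0n !(scale0r, mul0r, mulr0).
by rewrite /= -scaler_nat -!scalerAr -scalerAl exprS mulrCA mulrA.
Qed.

Section Wronskian.
Variables (k : fieldType) (p : nat).
Hypothesis hp : p \in [pchar k].
Implicit Types (a b : {poly k}).

Lemma natr_lt_inj m n : (m < p)%N -> (n < p)%N -> m%:R = n%:R :> k -> m = n.
Proof.
wlog mn : m n / (m <= n)%N => [H|] mp np e.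
  by case/orP: (leq_total m n) => ?; [|symmetry]; apply: H.
have : (n - m)%:R == 0 :> k by rewrite natrB // e subrr.
rewrite -(dvdn_pcharf hp); case: (posnP (n - m)) => [|nm0 /(dvdn_leq nm0)]; lia.
Qed.

(** The coefficient of the bracket of [a D] and [b D]. *)
Definition wronskian a b := b^`() * a - a^`() * b.

Lemma wronskian_subZ a b c : wronskian a (b - c *: a) = wronskian a b.
Proof. by rewrite /wronskian derivB derivZ -!mul_polyC; ring. Qed.

Lemma wronskian_addZ a b c : wronskian (a + c *: b) b = wronskian a b.
Proof. by rewrite /wronskian derivD derivZ -!mul_polyC; ring. Qed.

(** The first summand carries the lowest term: orders [s] and [t] yield a
    Wronskian of order at least [s + t - 1], with leading coefficient
    [(t - s) al_0 be_0]. *)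
Lemma mulX_wronskian s t (al be : {poly k}) :
  'X * wronskian (al * 'X^s) (be * 'X^t) =
  ((t%:R - s%:R) *: (al * be) + 'X * wronskian al be) * 'X^(t + s).
Proof.
have -> a b : 'X * wronskian a b = 'X * b^`() * a - 'X * a^`() * b.
  by rewrite /wronskian; ring.
rewrite !mulX_derivMXn exprD /wronskian scalerBl !scalerAl -!mul_polyC.
ring.
Qed.

Lemma wronskian_order a b s t n :
  (forall m, (m < s)%N -> a`_m = 0) -> (forall m, (m < t)%N -> b`_m = 0) ->
  (n.+1 < t + s)%N -> (wronskian a b)`_n = 0.
Proof.
move=> /poly_order_ge[al ->] /poly_order_ge[be ->] nst.
have := congr1 (fun q : {poly k} => q`_n.+1) (mulX_wronskian s t al be).
by rewrite mulrC coefMX coefMXn nst.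
Qed.

(** The constant [c] is chosen so that [b - c a] has no coefficient in degree
    [s], the only degree below [p] in which the factor [m - s] of the lowest
    term of the Wronskian vanishes.  In increasing order of [m], the
    coefficients of [b - c a] are then killed by those of the Wronskian in
    degree [m + s - 1], which are known to vanish only below degree [p]. *)
Lemma wronskian_lowest a b s c : (s < p)%N ->
  (forall m, (m < s)%N -> a`_m = 0) -> a`_s != 0 -> c = b`_s / a`_s ->
  (forall n, (n < p)%N -> (wronskian a b)`_n = 0) ->
  forall m, (m < p)%N -> (m + s < p.+1)%N || (m == s) -> (b - c *: a)`_m = 0.
Proof.
move=> sp /poly_order_ge[al eal] as0 ec; rewrite -/(wronskian a b).
move=> w0; have {}w0 n : (n < p)%N -> (wronskian a (b - c *: a))`_n = 0.
  by rewrite wronskian_subZ; apply: w0.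
set b2 := b - c *: a in w0 *; have b2s : b2`_s = 0.
  by rewrite coefB coefZ ec divfK // subrr.
elim/ltn_ind => m IHm mp /orP[ms|/eqP -> //].
have [->//|nms] := eqVneq m s.
have /poly_order_ge[be ebe] : forall j, (j < m)%N -> b2`_j = 0.
  by move=> j jm; apply: IHm => //; lia.
have eW := mulX_wronskian s m al be; rewrite -eal -ebe in eW.
have : ('X * wronskian a b2)`_(m + s) = 0.
  by rewrite mulrC coefMX; case: ifP => // ms0; apply: w0; lia.
rewrite eW coefMXn ltnn subnn coefD coefZ ['X * _]mulrC coefMX addr0 coef0M.
move=> /eqP.
have -> : al`_0 = a`_s by rewrite eal coefMXn ltnn subnn.
rewrite mulf_eq0 mulf_eq0 (negPf as0) subr_eq0 /= => /orP[/eqP/natr_lt_inj e|].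
  by case/eqP: nms; apply: e.
by rewrite ebe coefMXn ltnn subnn => /eqP.
Qed.

End Wronskian.

(** * Coordinates on the Witt algebra *)

Section WittCoordinates.
Variables (k : fieldType) (p : nat).
Hypothesis hp : p \in [pchar k].
Local Notation A := (truncpoly k p).
Local Notation x_ := (qpolyX ('X^p : {poly k})).
Local Notation g := (subvs_of (witt k p)).
Local Notation inA := (in_qpoly ('X^p : {poly k})).

Let p0 : (0 < p)%N := prime_gt0 (pcharf_prime hp).
Let p1 : (1 < p)%N := prime_gt1 (pcharf_prime hp).

Lemma coef_in_truncpoly (q : {poly k}) n :
  (inA q : {poly k})`_n = if (n < p)%N then q`_n else 0.
Proof.
have -> : (inA q : {poly k}) = Pdiv.Ring.rmodp q 'X^p.
  by rewrite /= mk_monic_Xn prednK.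
have := Pdiv.RingMonic.rdivp_eq (monicXn k p) q.
set r := Pdiv.Ring.rmodp _ _ => e.
case: ltnP => np; first by rewrite [in RHS]e coefD coefMXn np add0r.
apply: nth_default; apply: leq_trans np.
have := Pdiv.CommonRing.ltn_rmodpN0 q (monic_neq0 (monicXn k p)).
by rewrite size_polyXn.
Qed.

Lemma in_truncpoly_eq0 (q : {poly k}) :
  inA q = 0 <-> forall n, (n < p)%N -> q`_n = 0.
Proof.
split=> [q0 n np|q0].
  by have := coef_in_truncpoly q n; rewrite np q0 coef0.
apply/val_inj/polyP => n /=; rewrite [LHS]coef_in_truncpoly coef0.
by case: ifP => // /q0.
Qed.

(** A derivation is [a D], where [a] is its value at the variable; [wpoly] is
    this [a], represented by a polynomial of degree less than [p]. *)
Definition wpoly (x : g) : {poly k} := val (vsval x x_).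

Lemma wpoly_is_linear : linear wpoly.
Proof. by move=> c x y; rewrite /wpoly linearP /= add_lfunE scale_lfunE. Qed.

HB.instance Definition _ :=
  GRing.isLinear.Build k g {poly k} _ wpoly wpoly_is_linear.

Lemma wpoly_coef_scalar i : scalar (fun x : g => (wpoly x)`_i).
Proof. by move=> c x y; rewrite linearP coefD coefZ. Qed.

Lemma coef_wpoly_ge x n : (p <= n)%N -> (wpoly x)`_n = 0.
Proof.
move=> pn; rewrite /wpoly -(in_truncpoly_val (vsval x x_)).
by rewrite coef_in_truncpoly ltnNge pn.
Qed.

Lemma wittE (x : g) (q : {poly k}) : vsval x (inA q) = inA (q^`() * wpoly x).
Proof.
have dx : is_derivation (vsval x) by apply/(wittP _ p0)/subvsP.
rewrite in_qpolyM [inA (wpoly x)]in_truncpoly_val.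
elim/poly_ind: q => [|q c IHq]; first by rewrite deriv0 in_qpoly0 linear0 mul0r.
rewrite in_qpolyD in_qpolyM linearD /= dx IHq derivD derivC addr0.
rewrite derivM derivX mulr1.
rewrite in_qpolyD !in_qpolyM -[inA 'X]/x_.
rewrite -[c%:P]alg_polyC in_qpolyZ linearZ /= in_qpoly1.
rewrite (derivation1 dx) scaler0 addr0.
by ring.
Qed.

Lemma wpoly_inj : injective wpoly.
Proof.
move=> x y e; apply/val_inj/derivation_ext => //; last exact: val_inj.
  by apply/(wittP _ p0)/subvsP.
by apply/(wittP _ p0)/subvsP.
Qed.

Lemma lie_eq0 (x y : g) : lie (vsval x) (vsval y) = 0 <->
  forall n, (n < p)%N -> (wronskian (wpoly x) (wpoly y))`_n = 0.
Proof.
have xy_w : lie (vsval x) (vsval y) \in witt k p.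
  by apply: lie_witt => //; apply: subvsP.
have ev : lie (vsval x) (vsval y) x_ = inA (wronskian (wpoly x) (wpoly y)).
  rewrite /lie add_lfunE opp_lfunE !comp_lfunE.
  have val_x (z : g) : vsval z x_ = inA (wpoly z).
    by rewrite [RHS]in_truncpoly_val.
  by rewrite !val_x !wittE -linearB /=.
rewrite -in_truncpoly_eq0 -ev; split=> [->|e0]; first by rewrite zero_lfunE.
apply: derivation_ext => //; first exact/(wittP _ p0).
  by apply/(wittP _ p0)/mem0v.
by rewrite e0 zero_lfunE.
Qed.

(** The basis vector [X^m D], which spans g_[m-1]. *)
Definition wmon m : g := vsproj (witt k p) (wittXD k p m).

Lemma wpoly_wmon m : (m < p)%N -> wpoly (wmon m) = 'X^m.
Proof.
move=> mp; rewrite /wpoly vsprojK ?wittXD_in // wittXDE.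
rewrite -[X in wittD _ _ X]expr1 wittD_Xn // scale1r mulr1.
apply/polyP => n; have -> : x_ ^+ m = inA 'X^m by rewrite rmorphXn.
rewrite coef_in_truncpoly coefXn; case: ifP => // /negbT; rewrite -leqNgt => pn.
by rewrite gtn_eqF // (leq_trans mp pn).
Qed.

Lemma wpoly_sum (c : nat -> k) n :
  (wpoly (\sum_(m < p) c m *: wmon m))`_n = if (n < p)%N then c n else 0.
Proof.
rewrite linear_sum coef_sum.
rewrite (eq_bigr (fun m : 'I_p => c m * (n == m)%:R)); last first.
  by move=> m _; rewrite linearZ /= wpoly_wmon // coefZ coefXn.
case: ltnP => [np|pn].
  rewrite (bigD1 (Ordinal np)) //= eqxx mulr1 big1 ?addr0 // => m.
  by rewrite -val_eqE /= eq_sym => /negPf ->; rewrite mulr0.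
by rewrite big1 // => m _; rewrite gtn_eqF ?mulr0 // (leq_trans (ltn_ord m)).
Qed.

Lemma witt_decomp (x : g) : x = \sum_(m < p) (wpoly x)`_m *: wmon m.
Proof.
apply/wpoly_inj/polyP => n; rewrite (wpoly_sum (fun m => (wpoly x)`_m)).
by case: ltnP => // /coef_wpoly_ge ->.
Qed.

Lemma witt_filtP (x : g) (i : nat) :
  vsval x \in witt_filt k p i%:Z <-> forall m, (m <= i)%N -> (wpoly x)`_m = 0.
Proof.
split.
  case/memv_sumP => vs vsP ex m mi.
  have vsin (j : 'I_p) : (i%:Z <= j%:Z - 1)%R ->
      exists c, vs j = vsval (c *: wmon j).
    move=> /vsP/vlineP[c ->]; exists c.
    by rewrite linearZ /= vsprojK // wittXD_in.
  rewrite /wpoly ex sum_lfunE raddf_sum coef_sum big1 // => j ij.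
  have [c ->] := vsin j ij; rewrite -[LHS]/((wpoly (c *: wmon j))`_m).
  rewrite linearZ /= wpoly_wmon //.
  by rewrite coefZ coefXn; case: eqP ij => [<-|]; [lia | rewrite mulr0].
move=> x0; rewrite {1}(witt_decomp x) linear_sum /=; apply: memv_suml => m _.
have [mi|mi] := leqP m i; first by rewrite x0 // scale0r mem0v.
have im : (i%:Z <= m%:Z - 1)%R by lia.
apply/memvZ; rewrite vsprojK ?wittXD_in //.
by apply: (subvP (sumv_sup m im (subvv _))); apply: memv_line.
Qed.

(** An element of g_1 raises the order of vanishing at [0] by at least one, so
    its [p]-th power maps everything into the ideal of [X^p]. *)
Lemma nil_filt1 (x : g) :
  (forall m, (m <= 1)%N -> (wpoly x)`_m = 0) -> nil_set k p x.
Proof.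
move=> /(@poly_order_ge _ 2)[a ea]; rewrite /nil_set /=; apply/lfunP => b.
rewrite zero_lfunE iter_comp_lfunE -(in_truncpoly_val b).
have H n : exists q : {poly k}, iter n (vsval x) (inA (val b)) = inA (q * 'X^n).
  elim: n => [|n [q eq]]; first by exists (val b); rewrite expr0 mulr1.
  exists ((n%:R *: q + 'X * q^`()) * a).
  rewrite iterS eq wittE ea; congr (inA _).
  transitivity ('X * (q * 'X^n)^`() * (a * 'X)); first by rewrite expr2; ring.
  by rewrite mulX_derivMXn exprS; ring.
have [q ->] := H p; apply/in_truncpoly_eq0 => n np.
by rewrite coefMXn np.
Qed.

(** On the quotient of [(X)] by [(X^2)] the derivation acts as multiplication by
    its coefficient in degree one, whose [p]-th power must vanish. *)
Lemma nil_coef1 (x : g) :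
  (wpoly x)`_0 = 0 -> nil_set k p x -> (wpoly x)`_1 = 0.
Proof.
move=> x0; have [|a ea] := @poly_order_ge _ 1 (wpoly x); first by case.
set a1 := (wpoly x)`_1 => /(congr1 (fun f : 'End(A) => f x_)).
rewrite zero_lfunE iter_comp_lfunE => xp0.
have H n : exists q : {poly k},
    iter n (vsval x) x_ = inA (((a1 ^+ n)%:P + q * 'X) * 'X).
  elim: n => [|n [q eq]].
    by exists 0; rewrite expr0 mul0r addr0 mul1r.
  have [r er] : exists r, a = a1%:P + r * 'X.
    have [|r er] := @poly_order_ge _ 1 (a - a1%:P).
      by case=> // _; rewrite coefB coefC /a1 ea coefMXn subrr.
    by exists r; rewrite -er addrC subrK.
  exists ((a1 ^+ n)%:P * r + (q *+ 2 + q^`() * 'X) * a).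
  rewrite iterS eq wittE ea expr1; congr (inA _).
  rewrite derivM derivX derivD derivC derivM derivX er exprSr rmorphM /=.
  by ring.
have [q eq] := H p; move: xp0; rewrite eq => /in_truncpoly_eq0/(_ 1 p1).
rewrite coefMX /= coefD coefMX coefC addr0 => /eqP.
by rewrite expf_eq0 => /andP[_ /eqP].
Qed.

End WittCoordinates.

(** * The commuting variety and its components *)

Section CommutingVariety.
Variables (k : closedFieldType) (p : nat).
Hypotheses (hp : p \in [pchar k]) (hp3 : (3 < p)%N).
Local Notation g := (subvs_of (witt k p)).
Local Notation E := (wmon k p).

Let p0 : (0 < p)%N := prime_gt0 (pcharf_prime hp).

(** Membership in g_i.  The indices are shifted by one: X^m D has degree
    [m - 1], so g_i is the span of the X^m D with [i < m]. *)
Definition filt i (x : g) : Prop := forall m, (m <= i)%N -> (wpoly x)`_m = 0.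

Lemma filt_le i j x : (i <= j)%N -> filt j x -> filt i x.
Proof. by move=> ij xj m mi; apply/xj/(leq_trans mi). Qed.

Lemma filt_lin i c x y : filt i x -> filt i y -> filt i (x + c *: y).
Proof.
move=> xi yi m mi; rewrite linearD linearZ /= coefD coefZ xi // yi //.
by rewrite mulr0 addr0.
Qed.

Lemma filt_mon i m : (m < p)%N -> (i < m)%N -> filt i (E m).
Proof.
move=> mp im n ni; rewrite wpoly_wmon // coefXn; case: eqP => // e.
by move: im; rewrite -e ltnNge ni.
Qed.

Lemma filt0 i : filt i 0.
Proof. by move=> m _; rewrite linear0 coef0. Qed.

Lemma coef_mon m n : (m < p)%N -> (wpoly (E m))`_n = (n == m)%:R.
Proof. by move=> mp; rewrite wpoly_wmon // coefXn. Qed.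

(** The pairs [(x, c x + w)] with [x] in g_i and [w] in g_(p-1-i).  Unlike
    [centralizing i], this set puts no open condition on [x], which makes it
    the image of an affine space. *)
Definition comm_pairs i : set (g * g) :=
  [set z | filt i z.1 /\ exists c, filt (p.-1 - i) (z.2 - c *: z.1)].

(** The set whose closure is [frakC k p i]. *)
Definition centralizing i : set (g * g) :=
  [set z | [/\ nil_set k p z.1, nil_set k p z.2, val z.1 \in witt_filt k p i%:Z,
               val z.1 \notin witt_filt k p (i%:Z + 1) &
               lie (val z.1) (val z.2) = 0]].

Definition index_range i := (1 <= i <= (p - 3) %/ 2)%N.

(** With [e := (p - 3) %/ 2] this is [p = 2 e + 3], from which [lia] derives all
    the comparisons of indices. *)
Lemma odd_p : p = ((p - 3) %/ 2).*2.+3.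
Proof.
have podd : odd p by case: (even_prime (pcharf_prime hp)) hp3 => // ->.
by lia.
Qed.

Lemma index_rangeP i : index_range i -> (1 <= i)%N /\ (i.*2.+3 <= p)%N.
Proof. by rewrite /index_range; lia. Qed.

Lemma comm_pairs_lie i z : comm_pairs i z -> lie (val z.1) (val z.2) = 0.
Proof.
move=> [xi [c yc]]; apply/(lie_eq0 hp) => n np.
rewrite -(wronskian_subZ _ _ c) -linearZ -linearB /=.
by apply: (@wronskian_order _ _ _ i.+1 (p.-1 - i).+1) => //; lia.
Qed.

Lemma comm_pairs_filt1 i z : index_range i -> comm_pairs i z ->
  filt 1 z.1 /\ filt 1 z.2.
Proof.
move=> /index_rangeP[i1 ip] [xi [c yc]].
have x1 : filt 1 z.1 by apply: filt_le xi.
split=> //; rewrite -[z.2](subrK (c *: z.1)); apply: filt_lin => //.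
by apply: filt_le yc; lia.
Qed.

Lemma notin_filtS i x : filt i x ->
  (val x \notin witt_filt k p (i%:Z + 1)) = ((wpoly x)`_i.+1 != 0).
Proof.
move=> xi; have -> : (i%:Z + 1 = i.+1%:Z)%R by lia.
congr (~~ _); apply/idP/idP => [/(witt_filtP hp) xi1|/eqP xi1].
  by rewrite xi1.
apply/(witt_filtP hp) => m; rewrite leq_eqVlt => /orP[/eqP -> //|]; exact: xi.
Qed.

Lemma comm_pairs_centralizing i z : index_range i -> comm_pairs i z ->
  (wpoly z.1)`_i.+1 != 0 -> centralizing i z.
Proof.
move=> ir Rz xi; have [x1 y1] := comm_pairs_filt1 ir Rz.
split; [exact: nil_filt1 | exact: nil_filt1 | | | exact: comm_pairs_lie Rz].
  by apply/(witt_filtP hp); case: Rz.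
by rewrite notin_filtS //; case: Rz.
Qed.

(** The case [m = s] of the conclusion is used for [x] in g_(e+1) but not in
    g_(e+2), where [e = (p-3)/2]: there it places [y - c x] one step deeper in
    the filtration than the condition [m + s <= p] alone. *)
Lemma commute_lowest s x y :
  (0 < s < p)%N -> filt s.-1 x -> (wpoly x)`_s != 0 ->
  lie (val x) (val y) = 0 ->
  exists c, forall m, (m + s <= p)%N || (m == s) -> (wpoly (y - c *: x))`_m = 0.
Proof.
move=> /andP[s0 sp] xs xs0 /(lie_eq0 hp) w0.
exists ((wpoly y)`_s / (wpoly x)`_s) => m ms.
rewrite linearB linearZ /=.
apply: (wronskian_lowest hp sp _ xs0 erefl w0); [|lia|by rewrite ltnS].
by move=> j js; apply: xs; lia.
Qed.

Lemma centralizing_comm_pairs i :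
  index_range i -> centralizing i `<=` comm_pairs i.
Proof.
move=> /index_rangeP[i1 ip] [x y] [_ _ /(witt_filtP hp) /= xi].
rewrite notin_filtS // => xi0 xy0.
have [||c yc] := @commute_lowest i.+1 x y _ _ xi0 xy0 => //; first by lia.
by split=> //; exists c => m mi; apply: yc; lia.
Qed.

(** A pair in [comm_pairs i] whose first entry lies in g_(i+1) is the limit for
    [t -> 0] of the pairs obtained by adding [t X^(i+1) D] to that entry and
    [c] times this to the second one. *)
Lemma frakCE i : index_range i -> frakC k p i = zclosure (comm_pairs i).
Proof.
move=> ir; have [i1 ip] := index_rangeP ir; have Eip : (i.+1 < p)%N by lia.
rewrite -[frakC k p i]/(zclosure (centralizing i)); apply/seteqP.
split; apply: zclosure_min; try exact: zclosure_closed.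
  move=> z /(centralizing_comm_pairs ir); exact: zclosure_subset.
move=> z Rz; have [xi [c yc]] := Rz.
have [xi0|xi0] := eqVneq (wpoly z.1)`_i.+1 0; last first.
  by apply: zclosure_subset; apply: comm_pairs_centralizing.
pose h (t : k^o) := z + t *: (E i.+1, c *: E i.+1).
have -> : z = h 0 by rewrite /h scale0r addr0.
apply: zclosed_curve => [||t t0].
- exact: zclosure_closed.
- exact: regmap_line.
apply: zclosure_subset; apply: comm_pairs_centralizing => //.
  split=> /=; first by apply: filt_lin => //; apply: filt_mon.
  exists c; rewrite scalerDr opprD addrACA !scalerA [t * c]mulrC subrr addr0.
  exact: yc.
by rewrite /= linearD linearZ /= coefD xi0 add0r coefZ coef_mon // eqxx mulr1.
Qed.

(** Extended by zero, so that the formulas below may use arbitrary natural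
    numbers as indices. *)
Definition param_coef (t : 'rV[k]_(p.-1)) n : k :=
  if insub n is Some m then t 0 m else 0.

Lemma param_coef_lin n : scalar (param_coef^~ n).
Proof.
move=> a t u; rewrite /param_coef; case: insub => [m|]; first by rewrite !mxE.
by rewrite mulr0 addr0.
Qed.

(** For [i < p], a linear isomorphism onto g_i x g_(p-1-i).  The last [p - 1 - i]
    entries of [t] are the coefficients of the first component, in degrees
    [i+1], ..., [p-1], and the first [i] entries are those of the second
    component, in degrees [p-i], ..., [p-1]. *)
Definition param_pair i (t : 'rV[k]_(p.-1)) : g * g :=
  (\sum_(m < p) (if (i < m)%N then param_coef t m.-1 else 0) *: E m,
   \sum_(m < p)
      (if (p.-1 - i < m)%N then param_coef t (m - (p - i)) else 0) *: E m).

Lemma param_pair_coef1 i t n : (wpoly (param_pair i t).1)`_n =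
  if (i < n < p)%N then param_coef t n.-1 else 0.
Proof.
rewrite (wpoly_sum hp (fun m => if (i < m)%N then param_coef t m.-1 else 0)).
by rewrite andbC; case: ifP.
Qed.

Lemma param_pair_coef2 i t n : (wpoly (param_pair i t).2)`_n =
  if (p.-1 - i < n < p)%N then param_coef t (n - (p - i)) else 0.
Proof.
rewrite (wpoly_sum hp (fun m =>
  if (p.-1 - i < m)%N then param_coef t (m - (p - i)) else 0)).
by rewrite andbC; case: ifP.
Qed.

Lemma param_pair_linear i : linear (param_pair i).
Proof.
move=> a t u; apply/eqP; rewrite xpair_eqE; apply/andP; split; apply/eqP;
  apply/(wpoly_inj hp)/polyP => n; rewrite linearP /= coefD coefZ.
  rewrite !param_pair_coef1 param_coef_lin; case: ifP => // _.
  by rewrite mulr0 addr0.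
rewrite !param_pair_coef2 param_coef_lin; case: ifP => // _.
by rewrite mulr0 addr0.
Qed.

HB.instance Definition _ i :=
  GRing.isLinear.Build k 'rV[k]_(p.-1) (g * g)%type _
    (param_pair i) (param_pair_linear i).

(** Written as [(x, w) + c (0, x)], with [c] the first parameter. *)
Definition param i (w : k^o * 'rV[k]_(p.-1)) : g * g :=
  param_pair i w.2 + w.1 *: (0, (param_pair i w.2).1).

Lemma regmap_param i : regmap (param i).
Proof.
apply: regmapD.
  by apply: regmap_linear => a u v; rewrite /= linearP.
apply: regmapZ; first exact: regular_scalar.
apply: regmap_linear => a u v.
rewrite -[(a *: u + v).2]/(a *: u.2 + v.2) linearP.
by rewrite -[RHS]/(a *: 0 + 0, _) scaler0 addr0.
Qed.

Lemma filt_param_pair i t :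
  filt i (param_pair i t).1 /\ filt (p.-1 - i) (param_pair i t).2.
Proof.
split=> m mi; first by rewrite param_pair_coef1 ltnNge mi.
by rewrite param_pair_coef2 ltnNge mi.
Qed.

Lemma range_param i : index_range i -> range (param i) = comm_pairs i.
Proof.
move=> /index_rangeP[i1 ip]; apply/seteqP.
split=> [_ [[c t] _ <-]|[x y] [/= xi [c yc]]].
  have [t1 t2] := filt_param_pair i t; rewrite /param /=.
  split=> /=; first by rewrite scaler0 addr0.
  by exists c; rewrite scaler0 addr0 addrK.
pose t : 'rV[k]_(p.-1) := \row_j
  if (j < i)%N then (wpoly (y - c *: x))`_(j + (p - i)) else (wpoly x)`_j.+1.
have ex : (param_pair i t).1 = x.
  apply/(wpoly_inj hp)/polyP => n; rewrite param_pair_coef1 /param_coef.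
  case: ifP => [/andP[ni np]|/negbT]; last first.
    rewrite negb_and -!leqNgt => /orP[/xi ->//|]; by move/coef_wpoly_ge->.
  rewrite insubT; first by lia.
  by move=> H; rewrite mxE /= prednK ?ltnNge; [case: ifP => //; lia|lia].
have ey : (param_pair i t).2 = y - c *: x.
  apply/(wpoly_inj hp)/polyP => n; rewrite param_pair_coef2 /param_coef.
  case: ifP => [/andP[ni np]|/negbT]; last first.
    rewrite negb_and -!leqNgt => /orP[/yc ->//|]; by move/coef_wpoly_ge->.
  rewrite insubT; first by lia.
  by move=> H; rewrite mxE /= subnK; [case: ifP => //; lia|lia].
have ext : param_pair i t = (x, y - c *: x).
  by rewrite [LHS]surjective_pairing ex ey.
exists (c, t) => //; rewrite /param ext.
rewrite -[LHS]/(x + c *: 0, y - c *: x + c *: x).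
by rewrite scaler0 addr0 subrK.
Qed.

Local Notation C := (commuting_g1 k p).

Lemma zirreducible_comm_pairs i : index_range i -> zirreducible (comm_pairs i).
Proof.
by move=> ir; rewrite -range_param //; apply/zirreducible_image/regmap_param.
Qed.

Lemma zirreducible_frakC i : index_range i -> zirreducible (frakC k p i).
Proof.
move=> ir; rewrite frakCE //.
by apply/zirreducible_closure/zirreducible_comm_pairs.
Qed.

Lemma regular_coef1 m : regular (fun z : g * g => (wpoly z.1)`_m).
Proof. by apply: regular_scalar => a u v; apply: (wpoly_coef_scalar m). Qed.

Lemma regular_coef2 m : regular (fun z : g * g => (wpoly z.2)`_m).
Proof. by apply: regular_scalar => a u v; apply: (wpoly_coef_scalar m). Qed.

Lemma commuting_g1P z : C z <->
  [/\ filt 1 z.1, filt 1 z.2 & lie (val z.1) (val z.2) = 0].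
Proof.
split=> -[x1 y1 xy0]; split=> //; apply/(@witt_filtP k p hp _ 1%N) => //.
Qed.

Lemma zclosed_filt1 i : zclosed [set z : g * g | filt i z.1].
Proof. by apply: zclosed_zeros => m _; apply: regular_coef1. Qed.

Lemma zclosed_filt2 i : zclosed [set z : g * g | filt i z.2].
Proof. by apply: zclosed_zeros => m _; apply: regular_coef2. Qed.

(** By [lie_eq0], commutation is the vanishing of the coefficients of a
    Wronskian, which are polynomials in the coefficients of both entries. *)
Lemma zclosed_commuting : zclosed C.
Proof.
pose W : set (g * g) :=
  [set z | forall n, (n < p)%N -> (wronskian (wpoly z.1) (wpoly z.2))`_n = 0].
have -> : C = [set z | filt 1 z.1] `&` [set z | filt 1 z.2] `&` W.
  apply/seteqP; split=> z => [/commuting_g1P[x1 y1 /(lie_eq0 hp)]//|].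
  by move=> [[x1 y1] xy]; apply/commuting_g1P; split=> //; apply/(lie_eq0 hp).
apply: zclosedI.
  by apply: zclosedI; [exact: zclosed_filt1 | exact: zclosed_filt2].
apply: zclosed_zeros => n _.
have rw (a b : g * g -> g) : (forall m, regular (fun z => (wpoly (a z))`_m)) ->
    (forall m, regular (fun z => (wpoly (b z))`_m)) ->
    regular (fun z => ((wpoly (b z))^`() * wpoly (a z))`_n).
  move=> ra rb; have -> : (fun z => ((wpoly (b z))^`() * wpoly (a z))`_n) =
      fun z => \sum_(j < n.+1)
        (j.+1%:R * (wpoly (b z))`_j.+1) * (wpoly (a z))`_(n - j).
    apply/funext => z; rewrite coefM; apply: eq_bigr => j _.
    by rewrite coef_deriv mulr_natl.
  apply: regular_sum => j; apply: regularM => //; apply: regularM => //.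
  exact: regular_cst.
have := regularB (rw fst snd regular_coef1 regular_coef2)
                 (rw snd fst regular_coef2 regular_coef1).
by congr regular; apply/funext => z; rewrite /wronskian coefB.
Qed.

Lemma frakC_sub i : index_range i -> frakC k p i `<=` C.
Proof.
move=> ir; rewrite frakCE //.
apply: zclosure_min; first exact: zclosed_commuting.
move=> z Rz; have [x1 y1] := comm_pairs_filt1 ir Rz.
by apply/commuting_g1P; split=> //; apply: comm_pairs_lie Rz.
Qed.

Lemma zclosed_union :
  zclosed (\bigcup_(i in [set i | index_range i]) frakC k p i).
Proof.
apply: (@zclosed_bigcup _ _ p); first by move=> i /index_rangeP[]; lia.
by move=> i _; apply: zclosure_closed.
Qed.

Let e := ((p - 3) %/ 2)%N.

(** If [x] starts in degree [s <= e + 1], then [i = s - 1] works.  If it starts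
    in degree [s = e + 2], then [x] is in g_(e+1), and [i = e] works because the
    constant of [commute_lowest] also removes the term of degree
    [s = p - 1 - e] from [y - c x]. *)
Lemma commuting_in_frakC z : C z -> ~ filt e.+2 z.1 ->
  (\bigcup_(i in [set i | index_range i]) frakC k p i) z.
Proof.
move=> /commuting_g1P[x1 y1 xy0] nx; have podd := odd_p; rewrite -/e in podd.
have exs : exists s, (wpoly z.1)`_s != 0.
  by move: nx => /existsNP[s /not_implyP[_ /eqP]]; exists s.
have [s xs0 smin] := ex_minnP exs.
have xs m : (m < s)%N -> (wpoly z.1)`_m = 0.
  by move=> ms; apply: contraTeq ms => /smin; rewrite -leqNgt.
have s_e : (s <= e.+2)%N.
  by rewrite leqNgt; apply/negP => es; apply: nx => m me; apply: xs; lia.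
have s2 : (1 < s)%N.
  by rewrite ltnNge; apply/negP => /x1/eqP; rewrite (negPf xs0).
have sp : (0 < s < p)%N by lia.
have [|c yc] := commute_lowest sp _ xs0 xy0.
  by move=> m ms; apply: xs; lia.
pose i := minn s.-1 e.
have ir : index_range i by rewrite /index_range -/e /i; lia.
exists i => //; rewrite frakCE //; apply: zclosure_subset.
split; first by move=> m mi; apply: xs; rewrite /i in mi; lia.
by exists c => m mi; apply: yc; rewrite /i in mi; lia.
Qed.

(** When [x] is in g_(e+2) and [y] is not, the pairs [(x + t y, y)] commute and
    their first entry is outside g_(e+2) for [t <> 0]. *)
Lemma commuting_decomposition :
  C = \bigcup_(i in [set i | index_range i]) frakC k p i.
Proof.
apply/seteqP; split=> [z Cz|z [i ir]]; last exact: frakC_sub.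
have podd := odd_p; rewrite -/e in podd.
have [nx|/contrapT xe] := pselect (~ filt e.+2 z.1).
  exact: commuting_in_frakC.
have [ye|ny] := pselect (filt e.+2 z.2).
  have ir : index_range e by rewrite /index_range -/e; lia.
  exists e => //; rewrite frakCE //; apply: zclosure_subset.
  split; first by apply: filt_le xe; lia.
  by exists 0; rewrite scale0r subr0; apply: filt_le ye; lia.
have /commuting_g1P[x1 y1 xy0] := Cz.
pose h (t : k^o) := z + t *: (z.2, 0).
have -> : z = h 0 by rewrite /h scale0r addr0.
apply: zclosed_curve => [||t t0].
- exact: zclosed_union.
- exact: regmap_line.
have eh : h t = (z.1 + t *: z.2, z.2).
  by rewrite -[LHS]/(z.1 + t *: z.2, z.2 + t *: 0) scaler0 addr0.
apply: commuting_in_frakC.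
  apply/commuting_g1P; rewrite eh; split=> //; first exact: filt_lin.
  apply/(lie_eq0 hp) => n np /=; rewrite linearD linearZ /=.
  by rewrite wronskian_addZ; have /(lie_eq0 hp) := xy0; apply.
rewrite eh /= => xty; apply: ny => m me; apply: (mulfI t0).
have := xty m me; rewrite linearD linearZ /= coefD coefZ xe // add0r mulr0.
by [].
Qed.

(** For [i < j], the pair [(X^(i+1) D, 0)] is in C(i) but not in g_j x g_j.  For
    [j < i], the coefficients in degrees [i + 1] and [p - i] of a pair
    [(x, c x + w)] in [comm_pairs j] are proportional, as [w] starts in degree
    [p - j]; the pair [(X^(i+1) D, X^(p-i) D)] of C(i) violates this. *)
Lemma frakC_sub_inj i j : index_range i -> index_range j ->
  frakC k p i `<=` frakC k p j -> i = j.
Proof.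
move=> ir jr; rewrite !frakCE // => ij.
have [i1 ip] := index_rangeP ir; have [j1 jp] := index_rangeP jr.
have Ei : (i.+1 < p)%N by lia.
have Rij z : comm_pairs i z -> zclosure (comm_pairs j) z.
  by move=> Rz; apply: ij; apply: zclosure_subset.
have [lij|lji|//] := ltngtP i j.
  have : filt j (E i.+1).
    have /Rij : comm_pairs i (E i.+1, 0).
      split; first exact: filt_mon.
      by exists 0; rewrite scale0r subrr; exact: filt0.
    by apply: (zclosure_min (@zclosed_filt1 j)) => z [].
  by move=> /(_ i.+1 lij)/eqP; rewrite coef_mon // eqxx oner_eq0.
pose f (z : g * g) := (wpoly z.1)`_i.+1 * (wpoly z.2)`_(p - i) -
                      (wpoly z.1)`_(p - i) * (wpoly z.2)`_i.+1.
have rf : regular f.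
  by apply: regularB; apply: regularM;
    first [exact: regular_coef1 | exact: regular_coef2].
have Epi : (p - i < p)%N by lia.
have : f (E i.+1, E (p - i)) = 0.
  have /Rij : comm_pairs i (E i.+1, E (p - i)).
    split; first exact: filt_mon.
    by exists 0; rewrite scale0r subr0; apply: filt_mon; lia.
  apply: (zclosure_min (zclosed_zero rf)) => -[x y] [/= _ [c yc]].
  have ey m : (m <= p.-1 - j)%N -> (wpoly y)`_m = c * (wpoly x)`_m.
    by move/yc/eqP; rewrite linearB linearZ /= coefB coefZ subr_eq0 => /eqP.
  by rewrite /f /= !ey; [ring | lia | lia].
rewrite /f /= !coef_mon // !eqxx mulr1 gtn_eqF ?mul0r ?subr0; last by lia.
by move/eqP; rewrite oner_eq0.
Qed.

Lemma dim_param_space : \dim {: (k^o * 'rV[k]_(p.-1))%type} = p.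
Proof. by rewrite dimvf -[LHS]/(1 + 1 * p.-1)%N; lia. Qed.

Lemma zchain_commuting_bound n Z : zchain C n Z -> (n <= p)%N.
Proof.
move=> chZ; have [/(_ n (leqnn n))[_ irrZ ZC] _] := chZ.
rewrite commuting_decomposition in ZC.
have [|i ir|i ir] := zirreducible_bigcup (n := p) _ _ irrZ ZC.
- by move=> i /index_rangeP[]; lia.
- exact: zclosure_closed.
rewrite frakCE // -range_param // => ZR.
by have := zchain_image_bound (@regmap_param i) chZ ZR; rewrite dim_param_space.
Qed.

Lemma param_pair_inj i : index_range i -> injective (param_pair i).
Proof.
move=> /index_rangeP[i1 ip] t u etu; apply/rowP => j; have jp := ltn_ord j.
have [ji|ij] := ltnP j i.
  have := congr1 (fun z : g * g => (wpoly z.2)`_(j + (p - i))) etu.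
  rewrite /= !param_pair_coef2 // addnK /param_coef insubT /=.
  rewrite (_ : (_ && _)) => [|]; last by lia.
  by congr (t 0 _ = u 0 _); apply: val_inj.
have := congr1 (fun z : g * g => (wpoly z.1)`_j.+1) etu.
rewrite /= !param_pair_coef1 // /param_coef insubT /=.
rewrite (_ : (_ && _)) => [|]; last by lia.
by congr (t 0 _ = u 0 _); apply: val_inj.
Qed.

(** The pair [(X^(i+1) D, X^(i+1) D)] is in C(i) but not in the subspace
    g_i x g_(p-1-i), because [i < p - 1 - i]. *)
Lemma frakC_chain i : index_range i -> exists Z, zchain (frakC k p i) p Z.
Proof.
move=> ir; have [i1 ip] := index_rangeP ir.
pose psi : 'Hom('rV[k]_(p.-1), (g * g)%type) := linfun (param_pair i).
have psiE t : psi t = param_pair i t by rewrite lfunE.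
have dU : \dim (limg psi) = p.-1.
  have := limg_ker_dim psi fullv.
  have /eqP -> : lker psi == 0%VS.
    by apply/lker0P => t u; rewrite !psiE; apply: param_pair_inj.
  by rewrite capv0 dimv0 add0n => ->; rewrite dimvf -[LHS]/(1 * p.-1)%N mul1n.
have := @zchain_flag k (g * g)%type (limg psi) (frakC k p i) (frakC k p i)
  (E i.+1, E i.+1).
rewrite dU prednK //; apply=> //.
- exact: zclosure_closed.
- exact: zirreducible_frakC.
- move=> _ /memv_imgP[t _ ->]; rewrite frakCE // psiE; apply: zclosure_subset.
  have [t1 t2] := filt_param_pair i t.
  by split=> //; exists 0; rewrite scale0r subr0.
- rewrite frakCE //; apply: zclosure_subset.
  split; first by apply: filt_mon; lia.
  by exists 1; rewrite scale1r subrr; apply: filt0.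
apply/negP => /memv_imgP[t _ et]; have [_ t2] := filt_param_pair i t.
move: t2; rewrite -psiE -et => /(_ i.+1).
rewrite /= coef_mon // ?eqxx; last by lia.
by move=> /(_ _)/eqP; rewrite oner_eq0 => H; have := H ltac:(lia).
Qed.

Lemma zdim_frakC i : index_range i -> zdim (frakC k p i) p.
Proof.
move=> ir; split; first exact: frakC_chain.
move=> n [Z [Zc Zlt]]; apply: (@zchain_commuting_bound n Z); split=> // j jn.
have [clZ irrZ ZF] := Zc j jn; split=> //; apply: subset_trans ZF _.
exact: frakC_sub.
Qed.

Lemma zdim_commuting : zdim C p.
Proof.
split=> [|n [Z chZ]]; last exact: zchain_commuting_bound chZ.
have podd := odd_p.
have ir : index_range 1 by rewrite /index_range; lia.
have [Z [Zc Zlt]] := frakC_chain ir; exists Z; split=> // j jn.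
have [clZ irrZ ZF] := Zc j jn; split=> //; apply: subset_trans ZF _.
exact: frakC_sub.
Qed.

Lemma nil_borelE : nil_borel k p = [set x | val x \in witt_filt k p 1].
Proof.
apply/seteqP; split=> x.
  move=> [/(@witt_filtP k p hp _ 0%N) x0 nx].
  apply/(@witt_filtP k p hp _ 1%N) => -[|[|//]] _; first exact: x0.
  by apply: nil_coef1 => //; apply: x0.
move=> /(@witt_filtP k p hp _ 1%N) x1; split; last exact: nil_filt1.
by apply/(@witt_filtP k p hp _ 0%N); apply: filt_le x1.
Qed.

End CommutingVariety.

Theorem theorem4p3 (k : closedFieldType) (p : nat)
    (hp : p \in [pchar k]) (hp3 : (3 < p)%N) :
  (* the nilpotent variety of the standard Borel subalgebra is g_1 *)
  nil_borel k p = [set x | val x \in witt_filt k p 1]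
  (* C(g_1) is reducible (for p = 5 the union below has a single term) *)
  /\ ((5 < p)%N -> ~ zirreducible (commuting_g1 k p))
  /\ zequidimensional (commuting_g1 k p)
  (* the decomposition into irreducible components *)
  /\ commuting_g1 k p =
       \bigcup_(i in [set i | (1 <= i <= (p - 3) %/ 2)%N]) frakC k p i
  /\ (forall i j : nat,
        (1 <= i <= (p - 3) %/ 2)%N -> (1 <= j <= (p - 3) %/ 2)%N ->
        frakC k p i = frakC k p j -> i = j)
  /\ (forall Z : set (subvs_of (witt k p) * subvs_of (witt k p)),
        zcomponent (commuting_g1 k p) Z <->
        exists2 i : nat, (1 <= i <= (p - 3) %/ 2)%N & Z = frakC k p i)
  /\ zdim (commuting_g1 k p) p.
Proof.
have bound i : index_range p i -> (i < p)%N by rewrite /index_range; lia.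
have clF i : index_range p i -> zclosed (frakC k p i).
  by move=> _; apply: zclosure_closed.
have components Z := zcomponent_bigcup Z bound clF
  (@zirreducible_frakC k p hp hp3)
  (@frakC_sub_inj k p hp hp3) (@commuting_decomposition k p hp hp3).
split; first exact: nil_borelE.
split.
  move=> p5 irrC; have podd := odd_p hp hp3.
  have ir1 : index_range p 1 by rewrite /index_range; lia.
  have ir2 : index_range p 2 by rewrite /index_range; lia.
  have Csub : commuting_g1 k p `<=`
      \bigcup_(i in [set i | index_range p i]) frakC k p i.
    by rewrite -commuting_decomposition.
  have [i ir Ci] := zirreducible_bigcup bound clF irrC Csub.
  have e1 : 1%N = i.
    apply: (@frakC_sub_inj k p) => //; apply: subset_trans Ci.
    exact: frakC_sub.
  have e2 : 2%N = i.
    apply: (@frakC_sub_inj k p) => //; apply: subset_trans Ci.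
    exact: frakC_sub.
  by rewrite -e2 in e1.
split; first by exists p => Z /components[i ir ->]; apply: zdim_frakC.
split; first exact: commuting_decomposition.
split.
  by move=> i j ir jr eij; apply: (@frakC_sub_inj k p) => //; rewrite eij.
split; first exact: components.
exact: zdim_commuting.
Qed.
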